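(* Let $E$ be the edge set of the complete graph on $n$ vertices, $K_n$, and let $B$ be the set of path subgraphs of $K_n$ of length $\hat{k}$ (that is, with $\hat{k}$ edges, or $\hat{k}+1$ vertices), with $\hat{k} \geq 2$, each path being regarded as a block via its set of edges. The pair $(E, B)$ forms a balanced incomplete block design, referred to as a KP design, if and only if $n = 2\hat{k} - 1$. In that case, $(E,B)$ is a block design with parameters $(v,b,r,k,\lambda)$ given by \begin{align*} v & = \binom{2 \hat{k} - 1}{2}, \\ b & = \frac{1}{2} P(2 \hat{k} - 1, \hat{k} + 1) = \frac{(2 \hat{k} - 1)!}{2 \cdot (\hat{k} - 2)!}, \\ r & = \hat{k} \cdot P(2 \hat{k} - 3, \hat{k} - 1) = \frac{\hat{k} \cdot (2 \hat{k} - 3)!}{(\hat{k} - 2)!}, \\ k & = \hat{k}, \\ \lambda & = (\hat{k} - 1) \cdot P(2 \hat{k} - 4, \hat{k} - 2) = \frac{(\hat{k} - 1) \cdot (2 \hat{k} - 4)!}{(\hat{k} - 2)!}. \end{align*}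
   Context: Graphs are finite, simple and undirected; edges are unordered pairs of distinct vertices. $K_n$ is the graph on $n$ vertices in which every two distinct vertices are adjacent. A path subgraph of length $m$ is a subgraph consisting of $m+1$ distinct vertices $x_0, x_1, \dots, x_m$ and the $m$ edges $\{x_{i-1}, x_i\}$, $1 \le i \le m$; it has no direction, so $x_0 x_1 \cdots x_m$ and $x_m \cdots x_1 x_0$ give the same path. A balanced incomplete block design (BIBD) with parameters $(v,b,r,k,\lambda)$ is an ordered pair $(V,B)$ of a set $V$ of varieties and a set $B$ of subsets of $V$ called blocks such that $|V| = v$, $|B| = b$, each variety is an element of exactly $r$ blocks, each block has size $k$ (with $k < v$), and each pair of varieties is a subset of exactly $\lambda$ blocks. $P(m,j) = m!/(m-j)!$ denotes the number of ordered selections of $j$ distinct elements from an $m$-element set.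
   Formalization: A block design is required to have at least one block; without this the ''only if'' fails, e.g. for n = 4 and k̂ = 5 there are no paths and the empty set of blocks meets the definition vacuously with b = r = λ = 0. *)

(* Defs.v *)
From mathcomp Require Import all_boot.

Set Implicit Arguments.
Unset Strict Implicit.
Unset Printing Implicit Defensive.

(* Graphs whose vertices lie in a finite type T: a pair (vertex set, edge set),
   an edge {x, y} being the 2-element set [set x; y]. *)
Definition graph (T : finType) : Type := ({set T} * {set {set T}})%type.
Definition vertices (T : finType) (G : graph T) : {set T} := G.1.
Definition edges (T : finType) (G : graph T) : {set {set T}} := G.2.

Definition subgraph (T : finType) (H G : graph T) : bool :=
  (vertices H \subset vertices G) && (edges H \subset edges G).

Definition complete_graph (n : nat) : graph 'I_n :=
  ([set: 'I_n], [set e : {set 'I_n} | #|e| == 2]).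

(* [widen_ord (leqnSn m) i] and [lift ord0 i] are the indices i and i + 1. *)
Definition path_graph (T : finType) (m : nat) (x : m.+1.-tuple T) : graph T :=
  ([set u in x],
   [set [set tnth x (widen_ord (leqnSn m) i); tnth x (lift ord0 i)]
      | i : 'I_m]).

(* These are unlabelled subgraphs: a vertex sequence and its reverse give the
   same element. *)
Definition path_subgraphs (T : finType) (G : graph T) (m : nat) :
    {set {set T} * {set {set T}}} :=
  [set H | subgraph H G &
     [exists x : m.+1.-tuple T, uniq x && (H == path_graph x)]].

Definition path_blocks (T : finType) (G : graph T) (m : nat) :
    {set {set {set T}}} :=
  [set edges H | H in path_subgraphs G m].

Record is_BIBD (T : finType) (V : {set T}) (B : {set {set T}})
    (v b r k lambda : nat) : Prop := IsBIBD {
  BIBD_blocks : forall C, C \in B -> C \subset V;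
  BIBD_v : #|V| = v;
  BIBD_b : #|B| = b;
  BIBD_r : forall x, x \in V -> #|[set C in B | x \in C]| = r;
  BIBD_k : forall C, C \in B -> #|C| = k;
  BIBD_incomplete : k < v;
  BIBD_lambda : forall x y, x \in V -> y \in V -> x != y ->
    #|[set C in B | [set x; y] \subset C]| = lambda }.

(* A design has at least one block: when B is empty, [is_BIBD] holds vacuously
   for every nonempty V, with b = r = lambda = 0 and any k < v. *)
Definition forms_BIBD (T : finType) (V : {set T}) (B : {set {set T}}) : Prop :=
  B != set0 /\ exists v b r k lambda, is_BIBD V B v b r k lambda.

(* Main.v *)
Require Import Defs.
From mathcomp Require Import all_boot all_order all_algebra.
From mathcomp Require Import all_fingroup zify.

Set Implicit Arguments.
Unset Strict Implicit.
Unset Printing Implicit Defensive.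
Import Order.TTheory GRing.Theory Num.Theory.

(** A block of the design is the edge set of a path, and it comes from exactly two
vertex sequences, the two directions of reading the path; so every count of
blocks is half a count of injective vertex sequences.

Three of these counts are immediate or nearly so.  The number of all sequences
gives [b].  An edge [{a, b}] lies on a path exactly when one of the words [ab],
[ba] occurs in the sequence, and two edges [{a, b}], [{a, c}] lie on it exactly
when [bac] or [cab] occurs.  Cutting a fixed word out of a sequence leaves an
arbitrary injective sequence over the other vertices together with the place of
the cut ([card_uniq_infix]), so the number [r] of blocks through an edge and the
number [lambda] of blocks through two adjacent edges follow, for every order [n]
of the complete graph.

Pairs of disjoint edges need no such count.  Counting the pairs (block through
[e], second edge of that block) in two ways shows that the numbers of blocks
through [e] and [f], summed over the edges [f] other than [e], add up to
[r * (kh - 1)] ([sum_card_path_pairs]).  If the design is balanced, each summand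
is the known [lambda], whence [r * (kh - 1) = lambda * ('C(n, 2) - 1)].  After
cancellation this is [2 * kh * (n - 2) = (n + 1) * (n - 2)], that is
[n = 2 * kh - 1] ([KP_design_order]).

Conversely, let [n = 2 * kh - 1].  Then that identity holds, so [lambda] is the
average number of blocks through [e] and another edge.  The edges adjacent to
[e] attain this average, and a permutation of the vertices that preserves [e]
can carry any edge disjoint from [e] to any other, so the edges disjoint from
[e] share one value, which must then be the average too
([card_blocks_two_edges_balanced]). *)

(** * Injective sequences that contain a given word *)

Definition splice (T : Type) (t y : seq T) (i : nat) : seq T :=
  take i y ++ t ++ drop i y.

Lemma size_splice (T : Type) (t : seq T) p (y : p.-tuple T) i :
  size (splice t y i) == p + size t.
Proof. by rewrite !size_cat addnCA -size_cat cat_take_drop size_tuple addnC. Qed.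

(** The sequences counted here are in bijection, through [splice], with the pairs
of an injective sequence of length [p] avoiding [t] and a cutting place among
[p.+1]; the word must be nonempty, as its first letter tells the place. *)
Lemma card_uniq_infix (T : finType) (t : seq T) p :
  uniq t -> t != [::] ->
  #|[set x : (p + size t).-tuple T | uniq x & infix t x]|
  = p.+1 * (#|T| - size t) ^_ p.
Proof.
move=> Ut t0.
pose D := setX [set y : p.-tuple T | all [predC t] y & uniq y] [set: 'I_p.+1].
pose F (yi : p.-tuple T * 'I_p.+1) := Tuple (size_splice t yi.1 yi.2).
have FK (y : p.-tuple T) i : all [predC t] y ->
    filter [predC t] (splice t y i) = y.
  move=> /all_filterP Ay; rewrite !filter_cat.
  rewrite (@eq_in_filter _ [predC t] pred0 t) ?filter_pred0 /=; last first.
    by move=> z /= ->.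
  by rewrite -filter_cat cat_take_drop.
have FI : {in D &, injective F}.
  move=> [y i] [z j]; rewrite !inE /= !andbT => /andP[Ay _] /andP[Az _].
  case=> e; have eyz : y = z.
    by apply: val_inj; rewrite /= -(FK y i Ay) e FK.
  rewrite -{}eyz in Az e *; congr (_, _); apply: val_inj => /=.
  case: t t0 Ut @D @F FK Ay Az e => // a t _ Ut _ _ _ Ay _.
  (* As [a] is not in [y], its position in the spliced word is the place [i]. *)
  move=> /(congr1 (index a)).
  have idx (k : 'I_p.+1) : index a (splice (a :: t) y k) = k.
    rewrite /splice index_cat ifN.
      by rewrite /= eqxx addn0 size_takel // size_tuple -ltnS.
    apply/negP => /mem_take ay.
    by move/allP: Ay => /(_ _ ay); rewrite /= inE eqxx.
  by rewrite !idx.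
have -> : [set x : (p + size t).-tuple T | uniq x & infix t x] = F @: D.
  apply/setP=> x; rewrite inE; apply/idP/imsetP.
    case/andP=> Ux /infixP [s1 [s2 ex]].
    have sz : size (s1 ++ s2) == p.
      have := size_tuple x; rewrite ex !size_cat => /eqP.
      by rewrite addnCA addnC eqn_add2r.
    have lei : size s1 < p.+1 by rewrite ltnS -(eqP sz) size_cat leq_addr.
    exists (Tuple sz, Ordinal lei).
      move: Ux; rewrite !inE /= andbT ex uniq_catCA cat_uniq => /and3P [_ H ->].
      rewrite andbT; apply/allP=> z zs /=; apply/negP=> zt.
      by case/hasP: H; exists z.
    by apply: val_inj; rewrite /= ex /splice /= take_size_cat // drop_size_cat.
  case=> -[y i]; rewrite !inE /= andbT => /andP[Ay Uy] -> /=; apply/andP; split.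
    rewrite /splice uniq_catCA cat_uniq Ut cat_take_drop Uy andbT /=.
    apply/hasPn=> z zy; exact: (allP Ay).
  by apply/infixP; exists (take i y), (drop i y).
rewrite card_in_imset // cardsX cardsT card_ord mulnC card_uniq_tuples.
congr (_ * _ ^_ _).
by rewrite -(card_uniqP Ut) -(cardC (mem t)) addnC addnK; apply: eq_card.
Qed.

(** * Edges of a vertex sequence *)

(** Lists, unlike tuples, allow induction on the path; [edges_path_graph] relates
this to the edges of [path_graph]. *)
Definition edge_seq (T : finType) (x : seq T) : seq {set T} :=
  if x is a :: s then pairmap (fun u v => [set u; v]) a s else [::].

Lemma edge_seqP (T : finType) (x : seq T) (e : {set T}) :
  reflect (exists2 uv, e = [set uv.1; uv.2] & infix [:: uv.1; uv.2] x)
    (e \in edge_seq x).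
Proof.
apply: (iffP idP).
  case: x => // a s; elim: s a => //= b s IH a; rewrite inE => /predU1P[->|/IH].
    by exists (a, b); rewrite //= !eqxx prefix0s.
  by case=> uv -> uvs; exists uv => //=; apply/orP; right.
case=> -[u v] /= -> {e}; case: x => // a s; elim: s a => [|b s IH] a.
  by rewrite /= andbF.
case/orP.
  by rewrite /= prefix0s andbT => /andP[/eqP-> /eqP->]; rewrite inE eqxx.
by move=> /IH; rewrite /= inE orbC => ->.
Qed.

Lemma mem_edge_seq (T : finType) (x : seq T) u v :
  ([set u; v] \in edge_seq x) = infix [:: u; v] x || infix [:: v; u] x.
Proof.
apply/edge_seqP/idP.
  case=> -[c d] /= /setP E cdx.
  have := E u; have := E v; have := E c; have := E d; rewrite !inE !eqxx !orbT /=.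
  move=> /orP[]/eqP ? /orP[]/eqP ? /esym/orP[]/eqP ? /esym/orP[]/eqP ?;
  by subst; rewrite cdx ?orbT.
by case/orP; [exists (u, v) | exists (v, u); rewrite // setUC].
Qed.

Lemma edge_seq_rev (T : finType) (x : seq T) : edge_seq (rev x) =i edge_seq x.
Proof.
move=> e; apply/edge_seqP/edge_seqP => -[[u v] -> i]; exists (v, u) => //=;
  rewrite 1?setUC //; move: i; rewrite -infix_rev ?revK //.
Qed.

Lemma edge_seq_sub (T : finType) (x : seq T) e u :
  e \in edge_seq x -> u \in e -> u \in x.
Proof.
case/edge_seqP=> -[c d] -> /= /mem_infix H; rewrite !inE => ue.
by apply: H; rewrite !inE.
Qed.

Lemma edge_seq_uniq (T : finType) (x : seq T) : uniq x -> uniq (edge_seq x).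
Proof.
case: x => // a s; elim: s a => // b s IH a /andP[abs Us] /=.
rewrite [uniq _]IH // andbT; apply: contra abs => H.
by apply: (@edge_seq_sub _ (b :: s) _ a H); rewrite !inE eqxx.
Qed.

Lemma size_edge_seq (T : finType) m (x : m.+1.-tuple T) : size (edge_seq x) = m.
Proof. by case/tupleP: x => a s /=; rewrite size_pairmap size_tuple. Qed.

Lemma card_edge_seq (T : finType) (x : seq T) e :
  uniq x -> e \in edge_seq x -> #|e| = 2.
Proof.
move=> Ux /edge_seqP[[u v] -> /= /infix_uniq /(_ Ux)] /=.
by rewrite inE andbT cards2 => ->.
Qed.

Lemma edges_path_graph (T : finType) m (x : m.+1.-tuple T) :
  edges (path_graph x) = [set e in edge_seq x].
Proof.
apply/setP=> e; rewrite inE; apply/imsetP/idP.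
  case=> i _ ->; case/tupleP: x => a s; rewrite !(tnth_nth a) /=.
  have lt : i < size s by rewrite size_tuple.
  have := mem_nth set0 (s := pairmap (fun u v => [set u; v]) a s) (n := i).
  rewrite size_pairmap => /(_ lt); rewrite (nth_pairmap a) //.
move=> /(nthP set0) [i]; rewrite size_edge_seq => lt <-; exists (Ordinal lt) => //.
case/tupleP: x => a s; rewrite !(tnth_nth a) /= (nth_pairmap a) //.
by rewrite size_tuple.
Qed.

(** * Adjacent edges on a path *)

Lemma uniq_cat_cons_inj (T : eqType) (a : T) p q p' q' :
  uniq (p ++ a :: q) -> p ++ a :: q = p' ++ a :: q' -> p = p' /\ q = q'.
Proof.
move=> U E; have U' := U; rewrite E in U'.
have notin s r : uniq (s ++ a :: r) -> a \notin s.
  by rewrite uniq_catC /= => /andP[]; rewrite mem_cat negb_or => /andP[].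
have sz : size p = size p'.
  move: (congr1 (index a) E); rewrite !index_cat !ifN ?(notin _ _ U) ?(notin _ _ U') //=.
  by rewrite eqxx !addn0.
by move/eqP: E; rewrite eqseq_cat // => /andP[/eqP-> /eqP[->]].
Qed.

(** The vertex [a] occurs once, so it has one predecessor and one successor: of
the two neighbours [b] and [c], one must be each. *)
Lemma two_edge_infix (T : finType) (x : seq T) a b c :
  uniq x -> b != c ->
  ([set a; b] \in edge_seq x) && ([set a; c] \in edge_seq x)
  = infix [:: b; a; c] x || infix [:: c; a; b] x.
Proof.
move=> Ux bc; rewrite !mem_edge_seq; apply/idP/idP.
  have split u v s : x = s ++ [:: u; a] ++ v -> x = rcons s u ++ a :: v.
    by rewrite cat_rcons.
  case/andP=> /orP[]/infixP[p [q E]] /orP[]/infixP[p' [q' E']].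
  - case: (@uniq_cat_cons_inj _ a p (b :: q) p' (c :: q')); rewrite -?E //.
    by move=> _ [bcE]; rewrite bcE eqxx in bc.
  - have {}E' := split _ _ _ E'.
    case: (@uniq_cat_cons_inj _ a p (b :: q) (rcons p' c) q'); rewrite -?E //.
    move=> _ qE; apply/orP; right; apply/infixP.
    by exists p', q; rewrite E' -qE cat_rcons.
  - have {}E := split _ _ _ E.
    case: (@uniq_cat_cons_inj _ a p' (c :: q') (rcons p b) q); rewrite -?E' //.
    move=> _ qE; apply/orP; left; apply/infixP.
    by exists p, q'; rewrite E -qE cat_rcons.
  - have {}E := split _ _ _ E; have {}E' := split _ _ _ E'.
    case: (@uniq_cat_cons_inj _ a (rcons p b) q (rcons p' c) q'); rewrite -?E //.
    by move=> /rcons_inj[_ bcE]; rewrite bcE eqxx in bc.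
have sub u v : infix [:: u; a; v] x -> infix [:: u; a] x && infix [:: a; v] x.
  case/infixP=> p [q E]; apply/andP; split; apply/infixP.
    by exists p, (v :: q).
  by exists (rcons p u), q; rewrite E cat_rcons.
by case/orP=> /sub/andP[-> ->]; rewrite !orbT.
Qed.

(** * A path is determined by its edges up to reversal *)

Lemma set2_inj (T : finType) (a : T) : injective (fun b => [set a; b]).
Proof.
move=> b c /setP E; have := E b; have := E c; rewrite !inE !eqxx !orbT /=.
by move=> /orP[]/eqP-> /esym/orP[]/eqP.
Qed.

Lemma edge_seq_head (T : finType) (a b c : T) s :
  uniq (a :: b :: s) -> [set a; c] \in edge_seq (a :: b :: s) -> c = b.
Proof.
move=> /andP[abs _]; rewrite /= inE => /predU1P[/set2_inj //|H].
by case/negP: abs; apply: (@edge_seq_sub _ (b :: s) _ a H); rewrite !inE eqxx.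
Qed.

(** From a known end the path can be followed: the only edge at [a] leads to the
second vertex, and erasing that edge leaves the edges of the rest. *)
Lemma edge_seq_inj_head (T : finType) (a : T) s s' :
  uniq (a :: s) -> uniq (a :: s') ->
  edge_seq (a :: s) =i edge_seq (a :: s') -> s = s'.
Proof.
elim: s s' a => [|b s IH] [|b' s'] a U U' E //.
- by have := E [set a; b']; rewrite /= inE eqxx.
- by have := E [set a; b]; rewrite /= inE eqxx.
have bb : b' = b.
  by apply: (@edge_seq_head _ a b b' s) => //; rewrite E /= inE eqxx.
subst b'; congr cons; apply: (IH _ b).
- by case/andP: U.
- by case/andP: U'.
move=> e; have := E e; rewrite /= !inE.
case: (eqVneq e [set a; b]) => //= -> _.
have no r : uniq (a :: b :: r) -> ([set a; b] \in edge_seq (b :: r)) = false.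
  move=> /andP[abr _]; apply/negP => H; case/negP: abr.
  by apply: (edge_seq_sub H); rewrite !inE eqxx.
by rewrite -/(edge_seq (b :: s)) -/(edge_seq (b :: s')) !no.
Qed.

(** The first vertex of [x] lies on one edge only, so it cannot be an inner vertex
of [y]; reversing [y] if necessary makes both sequences start there. *)
Lemma edge_seq_inj (T : finType) (x y : seq T) :
  1 < size x -> uniq x -> uniq y -> edge_seq x =i edge_seq y ->
  y = x \/ y = rev x.
Proof.
case: x => // a [|b s] // _ Ux Uy E.
have ay : a \in y.
  by apply: (@edge_seq_sub _ y [set a; b]); rewrite -?E /= !inE eqxx.
case/splitPr: ay Uy E => p q Uy E.
case: (lastP p) Uy E => [|p' u] Uy E.
  by left; congr cons; apply/esym/(edge_seq_inj_head Ux Uy).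
case: q Uy E => [|v q] Uy E.
  right; apply: (can_inj revK); rewrite revK rev_cat /=; congr cons.
  apply/esym/(edge_seq_inj_head Ux); first by rewrite -rev_rcons rev_uniq -cats1.
  by move=> e; rewrite E -edge_seq_rev rev_cat.
have uv : [set a; u] \in edge_seq (a :: b :: s) /\
          [set a; v] \in edge_seq (a :: b :: s).
  rewrite !E !mem_edge_seq; split; apply/orP; [right|left]; apply/infixP.
    by exists p', (v :: q); rewrite cat_rcons.
  by exists (rcons p' u), q.
case: uv => /(edge_seq_head Ux) eu /(edge_seq_head Ux) ev.
move: Uy; rewrite eu ev cat_uniq => /and3P[_ /hasPn /(_ b)].
by rewrite !inE eqxx orbT mem_rcons inE eqxx => /(_ isT).
Qed.

(** * Blocks as pairs of sequences *)

Definition path_edge_sets (T : finType) m : {set {set {set T}}} :=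
  [set [set e in edge_seq x] | x : m.+1.-tuple T & uniq x].

Lemma path_blocks_complete n m :
  path_blocks (complete_graph n) m = path_edge_sets 'I_n m.
Proof.
apply/setP=> C; apply/imsetP/imsetP.
  case=> H; rewrite inE => /andP[_ /existsP[x /andP[Ux /eqP ->]]] ->.
  by exists x; rewrite ?inE // edges_path_graph.
case=> x; rewrite inE => Ux ->; exists (path_graph x); rewrite ?edges_path_graph //.
rewrite inE; apply/andP; split; last by apply/existsP; exists x; rewrite Ux /=.
rewrite /subgraph subsetT edges_path_graph /=; apply/subsetP=> e.
by rewrite !inE => ex; apply/eqP; exact: card_edge_seq ex.
Qed.

Lemma uniq_rev_neq (T : eqType) (x : seq T) :
  1 < size x -> uniq x -> rev x != x.
Proof.
case: x => // a s; case: (lastP s) => // s' b _.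
rewrite rev_cons rev_rcons /= mem_rcons inE negb_or.
by move=> /andP[/andP[ab _] _]; apply: contra ab => /eqP[->].
Qed.

(** Each block is the edge set of exactly two sequences, [x] and [rev x], which
differ because they have at least two entries. *)
Lemma card_labelled_paths (T : finType) m (P : pred {set {set T}}) : 0 < m ->
  #|[set x : m.+1.-tuple T | uniq x & P [set e in edge_seq x]]|
  = 2 * #|[set C in path_edge_sets T m | P C]|.
Proof.
move=> m0; pose F (x : m.+1.-tuple T) := [set e in edge_seq x].
rewrite -!sum1dep_card (partition_big F (fun C => (C \in path_edge_sets T m) && P C)).
  rewrite big_distrr /=; apply: eq_bigr => C /andP[/imsetP[x]]; rewrite inE => Ux -> PC.
  rewrite sum1dep_card muln1.
  have sx : 1 < size x by rewrite size_tuple.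
  have <- : #|[set x; [tuple of rev x]]| = 2.
    by rewrite cards2 -val_eqE /= eq_sym uniq_rev_neq.
  apply: eq_card => y; rewrite !inE; apply/andP/idP.
    case=> /andP[Uy _] /eqP/setP E; have E' : edge_seq x =i edge_seq y.
      by move=> e; have := E e; rewrite !inE => ->.
    by case: (edge_seq_inj sx Ux Uy E') => H; apply/orP; [left|right]; apply/eqP/val_inj.
  have Erev : F [tuple of rev x] = F x.
    by apply/setP=> e; rewrite !inE edge_seq_rev.
  case/orP=> /eqP ->; first by rewrite Ux.
  by rewrite -/(F [tuple of rev x]) Erev eqxx rev_uniq Ux /F PC.
by move=> x /andP[Ux ->]; rewrite andbT; apply/imsetP; exists x; rewrite ?inE.
Qed.

Lemma card_path_edge_sets (T : finType) m : 0 < m ->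
  2 * #|path_edge_sets T m| = #|T| ^_ m.+1.
Proof.
move=> m0; rewrite -(card_uniq_tuples m.+1 T).
have := card_labelled_paths (T := T) predT m0.
rewrite (_ : [set C in _ | predT C] = path_edge_sets T m); last first.
  by apply/setP=> C; rewrite inE andbT.
move=> <-; apply: eq_card => x; rewrite !inE andbT.
by rewrite (_ : all _ _ = true) //; apply/allP.
Qed.

Lemma card_in_path_edge_sets (T : finType) (C : {set {set T}}) m :
  C \in path_edge_sets T m -> #|C| = m.
Proof.
case/imsetP=> x; rewrite inE => Ux ->.
by rewrite cardsE (card_uniqP (edge_seq_uniq Ux)) size_edge_seq.
Qed.

(** * Numbers of blocks through one edge and through two adjacent edges *)

(** If [t] starts with [ab], the letter just before the [a] is [b] in an
occurrence of [rev t], so an occurrence of both repeats [b]. *)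
Lemma infix_rev_uniq (T : eqType) (x t : seq T) : 1 < size t -> uniq x ->
  infix t x -> infix (rev t) x = false.
Proof.
case: t => // a [|b t] // _ Ux ti; apply/negP => /infixP[p' [q' E']].
case/infixP: ti => p [q E].
have Ut : uniq (a :: b :: t).
  by apply: infix_uniq Ux; apply/infixP; exists p, q.
case: (@uniq_cat_cons_inj _ a p (b :: t ++ q) (p' ++ rev (b :: t)) q').
- by rewrite -E.
- by rewrite -E E' (rev_cons a) cat_rcons catA.
move=> pE _; move: Ux; rewrite E pE rev_cons cat_uniq => /and3P[_ /hasPn /(_ b)].
by rewrite !inE eqxx orbT mem_cat mem_rcons inE eqxx orbT => /(_ isT).
Qed.

Lemma card_uniq_infix_or (T : finType) (t : seq T) p :
  1 < size t -> uniq t ->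
  #|[set x : (p + size t).-tuple T | uniq x & infix t x || infix (rev t) x]|
  = 2 * (p.+1 * (#|T| - size t) ^_ p).
Proof.
move=> st Ut; have t0 : t != [::] by case: t st {Ut}.
have H r : size r = size t -> uniq r -> r != [::] ->
    #|[set x : (p + size t).-tuple T | uniq x & infix r x]|
    = p.+1 * (#|T| - size t) ^_ p by move=> <-; apply: card_uniq_infix.
rewrite mul2n -addnn -{1}(H t) // -(H (rev t)) ?size_rev ?rev_uniq //; last first.
  by rewrite -size_eq0 size_rev size_eq0.
rewrite -cardsUI (_ : _ :&: _ = set0) ?cards0 ?addn0.
  by apply: eq_card => x; rewrite !inE andb_orr.
apply/setP=> x; rewrite !inE; apply/negP => /andP[/andP[Ux H1] /andP[_ H2]].
by rewrite (infix_rev_uniq st Ux H1) in H2.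
Qed.

Lemma card_blocks_edge (T : finType) (e : {set T}) m : #|e| = 2 ->
  #|[set C in path_edge_sets T m.+1 | e \in C]| = m.+1 * (#|T| - 2) ^_ m.
Proof.
move/eqP/cards2P=> [a [b [ab ->]]].
apply/eqP; rewrite -(eqn_pmul2l (isT : 0 < 2)); apply/eqP.
rewrite -card_labelled_paths // -(@card_uniq_infix_or _ [:: a; b]) //=; last first.
  by rewrite inE ab.
by rewrite addn2; apply: eq_card => x; rewrite !inE mem_edge_seq.
Qed.

Lemma card_blocks_two_edges (T : finType) (a b c : T) m : uniq [:: a; b; c] ->
  #|[set C in path_edge_sets T m.+2 | [set [set a; b]; [set a; c]] \subset C]|
  = m.+1 * (#|T| - 3) ^_ m.
Proof.
move=> U; have /and3P[] := U; rewrite !inE negb_or => /andP[ab ac] bc _.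
apply/eqP; rewrite -(eqn_pmul2l (isT : 0 < 2)); apply/eqP.
rewrite -(card_labelled_paths (fun C => _ \subset C)) //.
rewrite -(@card_uniq_infix_or _ [:: b; a; c]) //=; last first.
  by rewrite !inE negb_or eq_sym ab bc ac.
rewrite addn3; apply: eq_card => x; rewrite !inE subUset !sub1set !inE.
by apply: andb_id2l => Ux; rewrite two_edge_infix.
Qed.

(** * Symmetry on pairs of disjoint edges *)

Lemma edge_seq_map (T T' : finType) (p : T -> T') (x : seq T) :
  edge_seq (map p x) = map (fun e : {set T} => p @: e) (edge_seq x).
Proof.
by case: x => // a s; elim: s a => //= b s -> a; rewrite imsetU !imset_set1.
Qed.

Lemma card_blocks_perm (T : finType) (p : {perm T}) (e f : {set T}) m : 0 < m ->
  #|[set C in path_edge_sets T m | [set p @: e; p @: f] \subset C]|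
  = #|[set C in path_edge_sets T m | [set e; f] \subset C]|.
Proof.
move=> m0; apply/eqP; rewrite -(eqn_pmul2l (isT : 0 < 2)); apply/eqP.
rewrite -!(card_labelled_paths (fun C => _ \subset C)) //.
pose F (x : m.+1.-tuple T) := [tuple of map p x].
have FI : injective F.
  by move=> x y [] /(inj_map (@perm_inj _ p)) /val_inj.
rewrite -(card_preimset _ FI); apply: eq_card => x.
rewrite !inE !subUset !sub1set !inE map_inj_uniq; last exact: perm_inj.
by rewrite edge_seq_map !mem_map //; apply: imset_inj; apply: perm_inj.
Qed.

(** If [f = {c, d}] and [f' = {c', d'}], exchange [c] with [c'], and then the image
of [d] with [d'].  No vertex of [e] takes part, and [c'] is not moved by the
second exchange, so this works also when [f] and [f'] overlap. *)
Lemma disjoint_edge_perm (T : finType) (e f f' : {set T}) :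
  #|f| = 2 -> #|f'| = 2 -> [disjoint e & f] -> [disjoint e & f'] ->
  exists2 p : {perm T}, p @: e = e & p @: f = f'.
Proof.
move=> /eqP/cards2P[c [d [cd ->]]] /eqP/cards2P[c' [d' [cd' ->]]] D D'.
have fixe (q : {perm T}) : {in e, forall x, q x = x} -> q @: e = e.
  move=> H; rewrite (eq_in_imset (g := id)) ?imset_id //.
have notin (g : {set T}) u x : [disjoint e & g] -> u \in g -> x \in e -> (u == x) = false.
  move=> Dg ug xe; apply/negP=> /eqP E; rewrite E in ug.
  by have := disjointFr Dg xe; rewrite ug.
pose p := tperm c c'; pose q := tperm (p d) d'.
have pe : {in e, forall x, p x = x}.
  move=> x xe; rewrite permE /= ![x == _]eq_sym.
  by rewrite (notin _ c x D) ?(notin _ c' x D') ?inE ?eqxx.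
have pd x : x \in e -> (p d == x) = false.
  by move=> xe; rewrite -{1}(pe x xe) (inj_eq perm_inj) (notin _ d x D) ?inE ?eqxx ?orbT.
exists (p * q)%g.
  apply: fixe => x xe; rewrite permM pe // permE /= ![x == _]eq_sym.
  by rewrite pd // (notin _ d' x D') ?inE ?eqxx ?orbT.
rewrite imsetU !imset_set1 !permM tpermL tpermL; congr [set _; _].
rewrite tpermD // eq_sym //.
by rewrite -{1}(tpermL c c') (inj_eq perm_inj).
Qed.

(** * Double counting and the order of the complete graph *)

(** Both sides count the pairs of a block [C] through [e] and a further element
of [C]. *)
Lemma sum_card_pairs (T : finType) (E : {set T}) (B : {set {set T}}) k e :
  {in B, forall C : {set T}, C \subset E /\ #|C| = k} ->
  \sum_(f in E :\ e) #|[set C in B | [set e; f] \subset C]|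
  = #|[set C in B | e \in C]| * k.-1.
Proof.
move=> H; under eq_bigr do rewrite -sum1dep_card big_mkcondr.
rewrite exchange_big -sum1dep_card big_distrl [RHS]big_mkcondr /=.
apply: eq_bigr => C CB; rewrite mul1n.
case: ifP => eC; last first.
  by apply: big1 => f _; rewrite subUset sub1set eC.
have [sC cC] := H C CB; rewrite -big_mkcondr sum1dep_card -cC (cardsD1 e C) eC /=.
apply: eq_card => f; rewrite !inE subUset !sub1set eC -andbA /=.
by congr (_ && _); case fC : (f \in C); rewrite ?andbF ?andbT ?(subsetP sC).
Qed.

Lemma sum_card_path_pairs (T : finType) (e : {set T}) m : #|e| = 2 ->
  \sum_(f in [set f : {set T} | #|f| == 2] :\ e)
     #|[set C in path_edge_sets T m.+1 | [set e; f] \subset C]|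
  = m.+1 * (#|T| - 2) ^_ m * m.
Proof.
move=> e2; rewrite (@sum_card_pairs _ _ _ m.+1) ?card_blocks_edge //.
move=> C CB; split; last exact: card_in_path_edge_sets CB.
case/imsetP: CB => x; rewrite inE => Ux ->; apply/subsetP=> f; rewrite !inE => fx.
by apply/eqP/(card_edge_seq Ux fx).
Qed.

Lemma edges_complete_graph n :
  edges (complete_graph n) = [set e : {set 'I_n} | #|e| == 2].
Proof. by []. Qed.

Lemma card_other_edges (T : finType) (e : {set T}) : #|e| = 2 ->
  #|[set f : {set T} | #|f| == 2] :\ e|.+1 = 'C(#|T|, 2).
Proof. by move=> /eqP e2; rewrite -card_draws [RHS](cardsD1 e) inE e2. Qed.

Lemma bin2_double n : 2 * 'C(n, 2) = n * n.-1.
Proof. by rewrite -mul_bin_diag bin1. Qed.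

(** Nonemptiness provides a path, hence the inequality [k + 3 <= n] that makes the
common factor [(n - 3) ^_ k] cancellable and three distinct vertices available;
two adjacent edges on them then reveal the value of [lam]. *)
Lemma KP_design_order (n k : nat) :
  forms_BIBD (edges (complete_graph n)) (path_edge_sets 'I_n k.+2) ->
  n = 2 * k + 3.
Proof.
case=> B0 [v [b [r [s [lam [_ _ _ _ _ _ Hlam]]]]]].
have : 0 < n ^_ k.+3.
  by rewrite -{1}(card_ord n) -card_path_edge_sets // muln_gt0 card_gt0.
rewrite ffact_gt0 => lekn; have n3 : 2 < #|'I_n| by rewrite card_ord; lia.
have {n3}[a [c [d [_ [ac cd da]]]]] := card_gt2P n3.
have e2 : #|[set a; c]| = 2 by rewrite cards2 ac.
have lamE : lam = k.+1 * (n - 3) ^_ k.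
  rewrite -(Hlam [set a; c] [set a; d]) ?inE ?e2 ?cards2 1?(eq_sym a d) ?da //.
    by rewrite card_blocks_two_edges ?card_ord //= !inE negb_or ac cd eq_sym da.
  by rewrite (inj_eq (@set2_inj _ a)).
have := sum_card_path_pairs k.+1 e2; have := card_other_edges e2.
rewrite (eq_bigr (fun=> lam)) => [|f]; last first.
  rewrite !inE => /andP[ef f2]; apply: Hlam; rewrite ?inE ?e2 // eq_sym //.
rewrite sum_nat_const card_ord lamE; set q := #|_| => qE.
have := bin2_double n; rewrite -{}qE.
have : 0 < (n - 3) ^_ k by rewrite ffact_gt0; lia.
rewrite ffactnS -subnS; move: (_ ^_ _) => F F0.
(* In terms of [j = n - 3], ['C(n, 2) - 1] is half of [(j + 1) * (j + 4)], which
   makes the factor [n - 2 = j + 1] cancel. *)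
have [j ->] : exists j, n = j + 3 by exists (n - 3); lia.
rewrite !addn3 /= !subSS subn0 => E1 E2.
have /eqP : q = k.+2 * j.+1.
  apply/eqP; rewrite -(eqn_pmul2r (_ : 0 < k.+1 * F)) ?muln_gt0 //; apply/eqP.
  by rewrite E2; nia.
nia.
Qed.

(** When [#|T| = 2 * k + 3], the right-hand side is the average, over the edges
[f] other than [e], of the left-hand side.  Adjacent edges have this value by
direct count and the disjoint ones share a single value by symmetry, so this
single value equals the average as well. *)
Lemma card_blocks_two_edges_balanced (T : finType) (e f : {set T}) k :
  #|T| = 2 * k + 3 -> #|e| = 2 -> #|f| = 2 -> e != f ->
  #|[set C in path_edge_sets T k.+2 | [set e; f] \subset C]|
  = k.+1 * (#|T| - 3) ^_ k.
Proof.
move=> cT e2 f2 ef.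
pose N (g : {set T}) := #|[set C in path_edge_sets T k.+2 | [set e; g] \subset C]|.
set lam := k.+1 * _; rewrite -/(N f).
have adj (g : {set T}) : #|g| = 2 -> e != g -> ~~ [disjoint e & g] -> N g = lam.
  move=> g2 eg /pred0Pn[a /= /andP[ae ag]].
  have other (h : {set T}) : #|h| = 2 -> a \in h ->
      exists2 b, b != a & h = [set a; b].
    move=> h2 ah; move: h2; rewrite (cardsD1 a) ah => -[] /eqP/cards1P[b hb].
    exists b; last by rewrite -hb setD1K.
    by have := set11 b; rewrite -hb !inE => /andP[].
  have [b ba eE] := other e e2 ae; have [c ca gE] := other g g2 ag.
  rewrite /N eE gE card_blocks_two_edges //= !inE negb_or eq_sym ba eq_sym ca /=.
  by rewrite andbT; apply: contra eg => /eqP bc; rewrite eE gE bc.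
have [def|] := boolP [disjoint e & f]; last exact: adj.
have dis (g : {set T}) : #|g| = 2 -> [disjoint e & g] -> N g = N f.
  move=> g2 deg; have [p pe pf] := disjoint_edge_perm f2 g2 def deg.
  by rewrite /N -{1}pe -pf card_blocks_perm.
pose E := [set g : {set T} | #|g| == 2] :\ e.
have : \sum_(g in E) N g = _ := sum_card_path_pairs k.+1 e2.
rewrite (bigID (fun g : {set T} => [disjoint e & g])) /=.
rewrite (eq_bigr (fun=> N f)) => [|g]; last first.
  by rewrite !inE => /andP[/andP[_ /eqP g2]]; apply: dis.
rewrite [X in _ + X](eq_bigr (fun=> lam)) => [|g]; last first.
  by rewrite !inE => /andP[/andP[ge /eqP g2]]; apply: adj; rewrite // eq_sym.
rewrite !sum_nat_cond_const.
have := card_other_edges e2; rewrite -/E -(cardID [pred g : {set T} | [disjoint e & g]]).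
set D := #|_|; set A := #|_|; set D' := #|_|; set A' := #|_|.
have -> : D' = D by apply: eq_card => g; rewrite !inE andbC.
have -> : A' = A by apply: eq_card => g; rewrite !inE andbC.
have D0 : 0 < D.
  by apply/card_gt0P; exists f; rewrite !inE def f2 eq_sym ef.
have := bin2_double #|T|; rewrite cT /lam !cT.
rewrite ffactnS -subnS; move: (_ ^_ _) => F.
rewrite (_ : 2 * k + 3 - 2 = 2 * k + 1); last by lia.
(* [D] edges are disjoint from [e] and [A] are adjacent to it: the sum is
   [D * N f + A * lam], to be compared with [(D + A) * lam]. *)
move=> E1 E2 E3; apply/eqP; rewrite -(eqn_pmul2l D0); apply/eqP.
nia.
Qed.

Lemma KP_design (n k : nat) : n = 2 * k + 3 ->
  is_BIBD (edges (complete_graph n)) (path_edge_sets 'I_n k.+2)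
    'C(n, 2) #|path_edge_sets 'I_n k.+2| (k.+2 * (n - 2) ^_ k.+1) k.+2
    (k.+1 * (n - 3) ^_ k).
Proof.
move=> nE; split.
- move=> C /imsetP[x]; rewrite inE => Ux ->; apply/subsetP=> f; rewrite !inE => fx.
  by apply/eqP/(card_edge_seq Ux fx).
- by rewrite edges_complete_graph card_draws card_ord.
- by [].
- move=> e; rewrite inE => /eqP e2; rewrite card_blocks_edge // card_ord //.
- by move=> C; apply: card_in_path_edge_sets.
- by have := bin2_double n; rewrite nE; nia.
move=> e f; rewrite !inE => /eqP e2 /eqP f2 ef.
by rewrite card_blocks_two_edges_balanced ?card_ord.
Qed.

Theorem theorem2p1 (n kh : nat) (kh_ge2 : 2 <= kh) :
  let E := edges (complete_graph n) in
  let B := path_blocks (complete_graph n) kh in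
  (forms_BIBD E B <-> n = 2 * kh - 1) /\
  (n = 2 * kh - 1 ->
   exists v b r k lambda : nat,
     is_BIBD E B v b r k lambda /\
     [/\ v = 'C(2 * kh - 1, 2),
         (b%:R = 1 / 2%:R * ((2 * kh - 1) ^_ (kh + 1))%:R :> rat)%R /\
         (b%:R = (2 * kh - 1)`!%:R / (2%:R * (kh - 2)`!%:R) :> rat)%R,
         r = kh * (2 * kh - 3) ^_ (kh - 1) /\
         (r%:R = kh%:R * (2 * kh - 3)`!%:R / (kh - 2)`!%:R :> rat)%R,
         k = kh &
         lambda = (kh - 1) * (2 * kh - 4) ^_ (kh - 2) /\
         (lambda%:R = (kh - 1)%:R * (2 * kh - 4)`!%:R / (kh - 2)`!%:R
            :> rat)%R]).
Proof.
move=> E B; have [k kE] : exists k, kh = k.+2 by exists (kh - 2); lia.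
subst kh; rewrite {}/B path_blocks_complete.
have nE : 2 * k.+2 - 1 = 2 * k + 3 by lia.
have card_b := card_path_edge_sets 'I_n (isT : 0 < k.+2).
rewrite card_ord in card_b.
split.
  rewrite nE; split=> [|n2k]; first exact: KP_design_order.
  split; last by do 5!eexists; exact: KP_design.
  rewrite -card_gt0 -(ltn_pmul2l (isT : 0 < 2)) muln0 card_b ffact_gt0; lia.
move=> n2k; rewrite nE in n2k *.
do 5!eexists; split; first exact: KP_design.
have -> : 2 * k.+2 - 3 = n - 2 by lia.
have -> : 2 * k.+2 - 4 = n - 3 by lia.
have -> : k.+2 - 1 = k.+1 by lia.
have -> : k.+2 - 2 = k by lia.
rewrite addn1 -n2k.
have ffactE a m : m <= a -> a - m = k -> ((a ^_ m)%:R = a`!%:R / k`!%:R :> rat)%R.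
  move=> le_ma ak; rewrite -(ffact_fact le_ma) ak natrM mulfK //.
  by rewrite pnatr_eq0 -lt0n fact_gt0.
have b2 : (#|path_edge_sets 'I_n k.+2|%:R = 1 / 2%:R * (n ^_ k.+3)%:R :> rat)%R.
  by rewrite -card_b natrM mulrA div1r mulVf // mul1r.
split=> //; split=> //.
- by rewrite b2 ffactE; [rewrite div1r invfM mulrCA | lia | lia].
- by rewrite natrM ffactE ?mulrA //; lia.
- by rewrite natrM ffactE ?mulrA //; lia.
Qed.
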